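(* Let $r\ge2$, $d\ge2$ and $n\ge\binom{r+d}{d}$ be integers. Let $\mathbf{p}\in X_{r,d,n}$ be a point configuration lying on a unique hypersurface $S\subseteq\mathbb{P}^r$ of degree $d$ and let $\mathbf{q}=\mathbf{p}\cap S^{\mathrm{sing}}$. Assume that all the points in $\mathbf{q}$ are distinct. Then the following hold: (i) If $|Z_{\mathbf{q}}|-\dim\langle Z_{\mathbf{q}}\rangle\le d$, then $X_{r,d,n}$ is smooth at $\mathbf{p}$. (ii) If $Z_{\mathbf{q}}$ is a set of at most $d+1$ distinct points, then $X_{r,d,n}$ is smooth at $\mathbf{p}$. (iii) Suppose $\mathrm{char}\,\Bbbk=0$. If the inequality $$d\ge\left\lceil\frac{|Z_{\mathbf{q}}|-\dim\langle Z_{\mathbf{q}}\rangle-1}{t(Z_{\mathbf{q}})}\right\rceil+1$$ holds, then $\mathbf{p}$ is a smooth point of $X_{r,d,n}$. (iv) Suppose $\mathrm{char}\,\Bbbk=0$. Assume that $Z_{\mathbf{q}}$ is in linearly general position in $\langle Z_{\mathbf{q}}\rangle$ and $d\ge\left\lceil\frac{|Z_{\mathbf{q}}|-1}{\dim\langle Z_{\mathbf{q}}\rangle}\right\rceil$. Then $\mathbf{p}$ is a smooth point of $X_{r,d,n}$.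
   Context: The base field $\Bbbk$ is arbitrary (not necessarily algebraically closed) unless restricted; a point of a scheme means a $\Bbbk$-rational point. $X_{r,d,n}\subseteq(\mathbb{P}^r)^n$ is the closed subscheme parametrizing $n$-tuples of points lying on a common degree $d$ hypersurface, with the scheme structure defined by the maximal minors (of size $\binom{r+d}{d}$) of the $\binom{r+d}{d}\times n$ matrix whose $i$-th column is the image of the $i$-th point under the degree $d$ Veronese embedding, i.e. the vector of all degree $d$ monomials in its homogeneous coordinates. $\mathbf{q}=\mathbf{p}\cap S^{\mathrm{sing}}$ is the tuple of those entries $p_i$ of $\mathbf{p}$ lying in the singular locus $S^{\mathrm{sing}}$ of $S$; $Z_{\mathbf{q}}$ is the closed reduced subscheme of $\mathbb{P}^r$ supported on the points of $\mathbf{q}$. For a finite subscheme $\Gamma\subseteq\mathbb{P}^r$, $|\Gamma|$ is its length and $\langle\Gamma\rangle$ is the smallest linear subspace of $\mathbb{P}^r$ containing the support of $\Gamma$. $\Gamma$ is $k$-general if $\dim\langle\Gamma'\rangle=k$ for any $\Gamma'\subseteq\Gamma$ with $|\Gamma'|=k+1$ (in other words, any $(k+1)$-subscheme is linearly independent); $t(\Gamma)$ is the largest $k$ such that $\Gamma$ is $k$-general. $\Gamma$ being in linearly general position in $\langle\Gamma\rangle$ means the case $t(\Gamma)=\dim\langle\Gamma\rangle$. *)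

(* Defs.v *)
From HB Require Import structures.
From mathcomp Require Import all_boot all_order all_algebra.
From mathcomp Require Import mpoly.

Set Implicit Arguments.
Unset Strict Implicit.
Unset Printing Implicit Defensive.

Import GRing.Theory.
Local Open Scope ring_scope.

(* A k-point of P^r is given by a nonzero row vector of homogeneous           *)
(* coordinates, v : 'rV[k]_r.+1; two of them give the same point when they    *)
(* span the same line, (u == v)%MS.                                           *)

Section AffineSchemes.
Variables (k : fieldType) (m : nat).

(* The ideal of k[x_1..x_m] generated by the finite family g. *)
Definition in_ideal (T : finType) (g : T -> {mpoly k[m]}) (h : {mpoly k[m]}) :=
  exists a : T -> {mpoly k[m]}, h = \sum_t a t * g t.

Definition jacobian (c : nat) (f : 'I_c -> {mpoly k[m]}) (a : 'I_m -> k) :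
    'M[k]_(c, m) :=
  \matrix_(s, j) ((f s)^`M(j)).@[a].

(* a is a smooth point (over k) of the closed subscheme V(g) of A^m: on some  *)
(* neighbourhood D(h) of a, the ideal of V(g) is generated by c of its        *)
(* elements whose differentials at a are linearly independent; see            *)
(* Bosch, Luetkebohmert, Raynaud, Neron Models, Definition 2.2/3.             *)
Definition smooth_point (T : finType) (g : T -> {mpoly k[m]}) (a : 'I_m -> k) :=
  (forall t, (g t).@[a] = 0) /\
  exists (c : nat) (f : 'I_c -> {mpoly k[m]}) (h : {mpoly k[m]}),
    [/\ forall s, in_ideal g (f s),
        h.@[a] != 0,
        forall t, in_ideal f (h * g t)
      & row_free (jacobian f a)].

End AffineSchemes.

(* The standard chart x_c = 1 of P^r: homogeneous coordinates of the point    *)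
(* with affine coordinates z, and affine coordinates of the point v.          *)
Definition chart_pt (R : nzRingType) (r : nat) (c : 'I_r.+1) (z : 'I_r -> R) :
    'I_r.+1 -> R :=
  fun l => if unlift c l is Some j then z j else 1.

Definition aff_coord (k : fieldType) (r : nat) (c : 'I_r.+1)
    (v : 'rV[k]_r.+1) : 'I_r -> k :=
  fun j => v ord0 (lift c j) / v ord0 c.

Section Hypersurfaces.
Variables (k : fieldType) (r d : nat).
Implicit Types (F : {mpoly k[r.+1]}) (v : 'rV[k]_r.+1).

(* A degree d hypersurface is given by its equation, a nonzero form of degree *)
(* d, which the hypersurface determines up to a nonzero scalar.               *)
Definition hypersurface F := F != 0 /\ F \is d.-homog.

Definition lies_on F v := F.@[v ord0] = 0.

Definition unique_hypersurface_through (n : nat) (p : 'I_n -> 'rV[k]_r.+1) F :=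
  [/\ hypersurface F, forall i, lies_on F (p i)
    & forall G, hypersurface G -> (forall i, lies_on G (p i)) ->
        exists2 a : k, a != 0 & G = a *: F].

Definition dehomog (c : 'I_r.+1) F : {mpoly k[r]} :=
  F \mPo [tuple chart_pt c (fun j : 'I_r => 'X_j : {mpoly k[r]}) l | l < r.+1].

Definition hypersurface_smooth_at F v :=
  exists2 c : 'I_r.+1, v ord0 c != 0
    & smooth_point (fun _ : unit => dehomog c F) (aff_coord c v).

Definition in_sing_locus F v := lies_on F v /\ ~ hypersurface_smooth_at F v.

End Hypersurfaces.

Section Veronese.
Variables (r d : nat).

Definition monoms : seq 'X_{1..r.+1} :=
  [seq s2m t | t : d.-tuple 'I_r.+1 <- enum (basis r.+1 d)].

Lemma mem_monoms (m : 'X_{1..r.+1}) : (m \in monoms) = (mdeg m == d).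
Proof. by rewrite basis_cover. Qed.

Lemma uniq_monoms : uniq monoms.
Proof. exact: uniq_basis. Qed.

Lemma size_monoms : size monoms = 'C(r + d, d).
Proof. by rewrite size_basis addnC. Qed.

Definition veronese_mx (R : comNzRingType) (n : nat)
    (x : 'I_n -> 'I_r.+1 -> R) : 'M[R]_('C(r + d, d), n) :=
  \matrix_(a, i) \prod_(l < r.+1) x i l ^+ (nth 0%MM monoms a l).

(* A maximal minor is indexed by the choice f of its columns. Non-increasing  *)
(* choices are allowed: they repeat the other minors up to sign, or give 0.   *)
Definition max_minor (R : comNzRingType) (n : nat)
    (f : {ffun 'I_('C(r + d, d)) -> 'I_n}) (x : 'I_n -> 'I_r.+1 -> R) : R :=
  \det (colsub f (veronese_mx x)).

End Veronese.

(* X_{r,d,n}, the closed subscheme of (P^r)^n cut out by the maximal minors.  *)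
Section XScheme.
Variables (k : fieldType) (r d n : nat).
Implicit Type p : 'I_n -> 'rV[k]_r.+1.

Definition in_X p :=
  forall f : {ffun 'I_('C(r + d, d)) -> 'I_n},
    max_minor f (fun i => p i ord0) = 0.

(* Equations in the chart A^(n * r) of (P^r)^n that is the product of the     *)
(* charts x_(c i) = 1; its coordinates are indexed by pairs (i, j).           *)
Definition X_chart_eqn (c : 'I_n -> 'I_r.+1)
    (f : {ffun 'I_('C(r + d, d)) -> 'I_n}) : {mpoly k[n * r]} :=
  max_minor f (fun i => chart_pt (c i)
    (fun j : 'I_r => 'X_(mxvec_index i j) : {mpoly k[n * r]})).

Definition X_aff_coord (c : 'I_n -> 'I_r.+1) p : 'I_(n * r) -> k :=
  mxvec (\matrix_(i < n, j < r) aff_coord (c i) (p i) j) ord0.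

Definition X_smooth_at p :=
  exists2 c : 'I_n -> 'I_r.+1, forall i, p i ord0 (c i) != 0
    & smooth_point (X_chart_eqn c) (X_aff_coord c p).

End XScheme.

(* Finite reduced subschemes of P^r supported on k-points. Given pairwise     *)
(* distinct points p i (i \in Q), the closed subschemes of the reduced scheme *)
(* Z supported on them are the ones supported on the p i with i \in G, for    *)
(* G \subset Q; the length of such a subscheme is #|G|.                       *)
Section FiniteSubschemes.
Variables (k : fieldType) (r n : nat) (p : 'I_n -> 'rV[k]_r.+1).
Implicit Types Q G : {set 'I_n}.

(* Projective dimension of the linear span; it is -1 for the empty scheme. *)
Definition proj_dim Q : int := (\rank (\sum_(i in Q) <<p i>>)%MS)%:Z - 1.

Definition is_general Q (e : int) : bool :=
  [forall G : {set 'I_n},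
     (G \subset Q) && (#|G|%:Z == e + 1) ==> (proj_dim G == e)].

(* The largest e with e + 1 <= #|Q| such that Z is e-general, the index of    *)
(* the maximum being e + 1. For larger e the condition is vacuous; the bound  *)
(* e + 1 <= #|Q| is what makes t <= proj_dim Q.                               *)
Definition t_general Q : int :=
  (\max_(e1 < #|Q|.+1 | is_general Q (e1%:Z - 1)) (e1 : nat))%:Z - 1.

End FiniteSubschemes.

(* Main.v *)
Require Import Defs.
From HB Require Import structures.
From mathcomp Require Import all_boot all_order all_algebra.
From mathcomp Require Import mpoly.
From mathcomp Require Import zify.

Set Implicit Arguments.
Unset Strict Implicit.
Unset Printing Implicit Defensive.

Import Order.TTheory GRing.Theory Num.Theory.
Local Open Scope ring_scope.

(** Let N be the number of monomials of degree d, let M be the N x n matrix of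
    Veronese vectors near p, and M(p) its value at p. A row in the left kernel
    of M(p) is a form of degree d vanishing at all the p_i, so uniqueness of the
    hypersurface says that M(p) has rank N - 1, with left kernel spanned by the
    coefficients of F. Near such a point the scheme of matrices of rank less
    than N is smooth of the expected codimension n - N + 1, and its tangent
    directions have a simple description: if w is the vector of cofactors of
    N - 1 independent columns, the entries of w M generate the ideal of maximal
    minors after inverting one coordinate of w ([det_smooth_point]). For nu in
    the right kernel of M(p), the differential at p of the combination w M nu is,
    up to a scalar, the sum of nu_i dF(p_i), because w(p) is proportional to F.
    The equations attached to a basis of the right kernel thus have independent
    differentials as soon as no nonzero relation nu between the Veronese vectors
    kills all the nu_i dF(p_i).

    If p_i is a smooth point of the hypersurface then dF(p_i) is nonzero
    ([smooth_grad]), so such a nu is supported on the singular points. Hence p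
    is a smooth point of X as soon as the singular points among the p_i impose
    independent conditions on forms of degree d, that is, as soon as for each
    of them some form of degree d vanishes at all the others but not at it
    ([X_smooth_if_separated]).

    In each of the four cases such a form is a product of linear forms. A linear
    form can separate p_i from any set of points whose span does not contain it.
    Under t-generality every set of t other points is of this kind, so the other
    points may be removed t at a time ([separated_groups]; distinct points are
    1-general). Moreover a set B of other points, maximal among those whose span
    avoids p_i, spans with p_i the whole span of Z, so it has at least dim <Z>
    elements: a single linear form removes dim <Z> points at once
    ([span_extension], [separated_rank]). *)

(** * The cofactor row of an N+1 by N matrix *)

Section CofactorRow.
Variables (R : comNzRingType) (N : nat).
Implicit Types (B : 'M[R]_(N.+1, N)) (v : 'cV[R]_N.+1).

(** The coefficients of the linear form sending a column v to the determinant
    of the square matrix (v | B). *)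
Definition cof_row B : 'rV[R]_N.+1 := \row_a ((-1) ^+ a * \det (row' a B)).

Lemma mul_cof_row B v :
  (cof_row B *m v) 0 0 = \det (row_mx v B : 'M_(N.+1, 1 + N)).
Proof.
have -> : \det (row_mx v B : 'M_(N.+1, 1 + N)) =
    \sum_a (row_mx v B : 'M_(N.+1, 1 + N)) a (@lshift 1 N ord0)
      * cofactor (row_mx v B : 'M_(N.+1, 1 + N)) a (@lshift 1 N ord0).
  exact: (@expand_det_col R N.+1).
rewrite !mxE; apply: eq_bigr => a _.
rewrite row_mxEl !mxE mulrC /cofactor /= addn0; congr (_ * (_ * \det _)).
apply/matrixP=> x y; rewrite !mxE.
have -> : lift (@lshift 1 N ord0) y = rshift 1 y by apply/val_inj.
by case: splitP => [[[]] //|y' /= /eqP]; rewrite eqn_add2l => /eqP/val_inj ->.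
Qed.

Lemma cof_row_mul_self B : cof_row B *m B = 0.
Proof.
apply/rowP=> j; rewrite [RHS]mxE.
have -> : (cof_row B *m B) 0 j = (cof_row B *m col j B) 0 0.
  by rewrite !mxE; apply: eq_bigr => a _; rewrite !mxE.
rewrite mul_cof_row -det_tr.
apply: (determinant_alternate (i1 := @lshift 1 N ord0) (i2 := rshift 1 j)) => //.
by move=> x; rewrite ![_^T _ _]mxE row_mxEl row_mxEr mxE.
Qed.

End CofactorRow.

Lemma map_cof_row (R S : comNzRingType) (f : {rmorphism R -> S}) N
    (B : 'M[R]_(N.+1, N)) : map_mx f (cof_row B) = cof_row (map_mx f B).
Proof.
apply/rowP=> a; rewrite !mxE rmorphM /= rmorph_sign -det_map_mx.
by congr (_ * \det _); apply/matrixP=> x y; rewrite !mxE.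
Qed.

(** The columns of B are independent, so some basis vector extends them to a
    basis of the whole space; the resulting nonzero determinant is a coordinate
    of the cofactor row. *)
Lemma cof_row_neq0 (k : fieldType) N (B : 'M[k]_(N.+1, N)) :
  row_free B^T -> cof_row B != 0.
Proof.
move=> Bfree; apply/eqP => w0.
have /row_subPn[i Hi] : ~~ (1%:M <= B^T)%MS.
  apply/negP => /mxrankS; rewrite mxrank1 (eqP Bfree); lia.
have free1 : row_free (row_mx (delta_mx i 0 : 'cV_N.+1) B)^T.
  rewrite tr_row_mx trmx_delta /row_free eqn_leq rank_leq_row -addsmxE /=.
  have [le1 eq1] := mxrank_leqif_sup (addsmxSr (delta_mx 0 i : 'rV_N.+1) B^T).
  move: le1 eq1; rewrite (eqP Bfree) addsmx_sub submx_refl andbT -row1.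
  by rewrite (negPf Hi) ltn_neqAle => -> ->.
have : \det (row_mx (delta_mx i 0) B : 'M_(N.+1, 1 + N)) != 0.
  by rewrite -unitfE -[_ \is a _]unitmxE -unitmx_tr -row_free_unit; exact: free1.
by rewrite -mul_cof_row w0 mul0mx mxE eqxx.
Qed.

(** * Smoothness of determinantal schemes at points of corank one *)

Section Ideals.
Variables (k : fieldType) (m : nat) (T : finType) (g : T -> {mpoly k[m]}).

Lemma in_ideal_gen t : in_ideal g (g t).
Proof.
exists (fun t' => (t' == t)%:R); rewrite (bigD1 t) //= eqxx mul1r big1 ?addr0 //.
by move=> t' /negPf ->; rewrite mul0r.
Qed.

Lemma in_idealMl b f : in_ideal g f -> in_ideal g (b * f).
Proof.
move=> [c ->]; exists (fun t => b * c t); rewrite mulr_sumr.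
by apply: eq_bigr => t _; rewrite mulrA.
Qed.

Lemma in_ideal_sum (I : finType) (f : I -> {mpoly k[m]}) :
  (forall i, in_ideal g (f i)) -> in_ideal g (\sum_i f i).
Proof.
move=> gf; elim/big_rec: _ => [|i x _ [b ->]].
  by exists (fun=> 0); rewrite big1 // => t _; rewrite mul0r.
have [c ->] := gf i; exists (fun t => c t + b t); rewrite -big_split /=.
by apply: eq_bigr => t _; rewrite mulrDl.
Qed.

End Ideals.

(** The hypotheses on u say that M(a) has corank one, with left kernel spanned
    by u. The last hypothesis says that on the right kernel of M(a) the linear
    map sending nu to the differential at a of u M nu is injective. *)
Section DeterminantalSmoothness.
Variables (k : fieldType) (m n N : nat).
Variables (M : 'M[{mpoly k[m]}]_(N.+1, n)) (a : 'I_m -> k).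
Let Ma := map_mx (meval a) M.
Variable u : 'rV[k]_N.+1.
Hypotheses (u_neq0 : u != 0) (uM : u *m Ma = 0)
  (u_uniq : forall v : 'rV_N.+1, v *m Ma = 0 -> (v <= u)%MS).
Hypothesis inj_grad : forall nu : 'cV[k]_n, Ma *m nu = 0 ->
  (forall l, \sum_i nu i 0 * (\sum_b u 0 b * ((M b i)^`M(l)).@[a]) = 0) -> nu = 0.

(** With B a choice of N independent columns of M and w its cofactor row, the
    entries of w M are maximal minors and vanish on the columns of B. Cramer's
    rule applied to w C expresses w_i0 times the minor of C through them. The
    equations used are the n - N combinations of these entries given by a basis K
    of the right kernel of M(a); on the kernel the derivative of w drops out,
    because it is multiplied by M(a). *)
Lemma det_smooth_point :
  smooth_point (fun f : {ffun 'I_N.+1 -> 'I_n} => \det (colsub f M)) a.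
Proof.
have rkMa : \rank Ma^T = N.
  have : (kermx Ma == u)%MS.
    apply/andP; split; last by apply/sub_kermxP.
    by apply/rV_subP=> v /sub_kermxP; apply: u_uniq.
  move/eqmx_rank; rewrite mxrank_ker mxrank_tr rank_rV u_neq0.
  have := rank_leq_row Ma; lia.
have [f0 f0P] : exists f0 : 'I_N -> 'I_n, row_free (rowsub f0 Ma^T).
  move: (maxrowsub_free Ma^T); move: (maxrankfun _); rewrite rkMa => f0 f0P.
  by exists f0.
pose B := colsub f0 M; pose w := cof_row B.
pose wa := map_mx (meval a) w.
have Ba : map_mx (meval a) B = colsub f0 Ma by apply: map_mxsub.
have wa0 : wa != 0.
  rewrite /wa map_cof_row Ba; apply: cof_row_neq0.
  by rewrite trmx_mxsub.
(* The columns of B span those of M(a), so w(a) also kills M(a). *)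
have waM : wa *m Ma = 0.
  have : (Ma^T <= rowsub f0 Ma^T)%MS.
    have sB : (rowsub f0 Ma^T <= Ma^T)%MS by apply: rowsub_sub.
    have [_ <-] := mxrank_leqif_sup sB; by rewrite (eqP f0P) rkMa.
  case/submxP=> D /(congr1 trmx); rewrite trmxK trmx_mul trmx_mxsub trmxK -Ba => ->.
  by rewrite mulmxA -map_mxM cof_row_mul_self map_mx0 mul0mx.
have /sub_rVP[x wau] : (wa <= u)%MS by apply: u_uniq.
have x0 : x != 0 by apply: contraNneq wa0 => x0; rewrite wau x0 scale0r.
have [i0 hi0] : exists i0, wa 0 i0 != 0 by apply/rV0Pn.
set g := fun f : {ffun 'I_N.+1 -> 'I_n} => _.
pose K := row_base (kermx Ma^T).
pose E : 'M[k]_(N, n) := rowsub f0 1%:M.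
pose eV := (w *m M)^T; pose e i : {mpoly k[m]} := eV i 0.
pose liftC p q (A : 'M[k]_(p, q)) := map_mx (@mpolyC m k) A.
(* The columns selected by f0 contribute nothing, so the combinations given by
   K, which complements them, generate all the entries e. *)
have eB j : e (f0 j) = 0.
  have /matrixP/(_ 0 j) := cof_row_mul_self B.
  by rewrite -/w mulmx_colsub [LHS]mxE [RHS]mxE /e /eV [_^T _ _]mxE.
have ge i : in_ideal g (e i).
  pose f : {ffun 'I_N.+1 -> 'I_n} :=
    [ffun b : 'I_(1 + N) => if split b is inr j then f0 j else i].
  suff -> : e i = g f by apply: in_ideal_gen.
  have -> : e i = (w *m col i M) 0 0.
    by rewrite /e /eV !mxE; apply: eq_bigr => b _; rewrite [col _ _ _ _]mxE.
  rewrite mul_cof_row; congr (\det _); apply/matrixP=> b c.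
  by rewrite !mxE ffunE; case: split => c'; rewrite mxE.
have KM : K *m Ma^T = 0 by apply/sub_kermxP; rewrite eq_row_base.
have K_free : row_free K by apply: row_base_free.
clearbody K.
have KE_full : row_full (col_mx K E).
  have cN : (\rank (kermx Ma^T) + N = n)%N.
    by rewrite mxrank_ker rkMa subnK // -rkMa rank_leq_row.
  suff : row_free (col_mx K E) by rewrite /row_full => /eqP ->; apply/eqP.
  apply: inj_row_free => v; rewrite -[v]hsubmxK mul_row_col => vKE.
  have y0 : rsubmx v = 0.
    apply: (row_free_inj f0P); rewrite /= mul0mx.
    have -> : rowsub f0 Ma^T = E *m Ma^T by rewrite /E mul_rowsub_mx mul1mx.
    have := congr1 (mulmx^~ Ma^T) vKE.
    by rewrite mulmxDl -mulmxA KM mulmx0 add0r mulmxA mul0mx.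
  move: vKE; rewrite y0 mul0mx addr0 => vK.
  suff -> : lsubmx v = 0 by rewrite row_mx0.
  by apply: (row_free_inj K_free); rewrite /= mul0mx.
pose fs s : {mpoly k[m]} := (liftC _ _ K *m eV) s 0.
have fsE s : fs s = \sum_i (K s i)%:MP * e i.
  by rewrite /fs mxE; apply: eq_bigr => i _; rewrite mxE.
have fe i : in_ideal fs (e i).
  have /submxP[D] : ((delta_mx 0 i : 'rV[k]_n) <= col_mx K E)%MS.
    by apply: submx_full.
  rewrite -[D]hsubmxK mul_row_col; set D1 := lsubmx D; set D2 := rsubmx D => eD.
  have E0 : liftC _ _ E *m eV = 0.
    apply/matrixP=> j z; rewrite ord1 /liftC /E map_mxsub map_mx1.
    by rewrite mul_rowsub_mx mul1mx mxE [eV _ _]eB mxE.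
  have -> : e i = \sum_s (D1 0 s)%:MP * fs s.
    transitivity ((liftC _ _ (delta_mx 0 i : 'rV[k]_n) *m eV) 0 0).
      by rewrite /liftC map_delta_mx -rowE mxE.
    rewrite eD /liftC map_mxD !map_mxM mulmxDl -!mulmxA E0 mulmx0 addr0 mxE.
    by apply: eq_bigr => s _; rewrite [map_mx _ D1 _ _]mxE.
  by apply: in_ideal_sum => s; apply/in_idealMl/in_ideal_gen.
have wi0 : (w 0 i0).@[a] != 0 by move: hi0; rewrite mxE.
split=> [f|].
  rewrite /g -det_map_mx map_mxsub; apply/eqP/det0P; exists u => //.
  by rewrite mulmx_colsub uM; apply/matrixP=> b c; rewrite !mxE.
exists (\rank (kermx Ma^T)), fs, (w 0 i0); split => //.
- by move=> s; rewrite fsE; apply: in_ideal_sum => i; apply: in_idealMl.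
- move=> f; pose C := colsub f M.
  have -> : w 0 i0 * g f = \sum_b (\adj C) b i0 * e (f b).
    have := congr1 (fun X => (w *m X) 0 i0) (mul_mx_adj C).
    rewrite mul_mx_scalar [X in _ = X]mxE mulrC => <-.
    rewrite mulmxA mulmx_colsub mxE; apply: eq_bigr => b _.
    by rewrite mulrC /e !mxE.
  by apply: in_ideal_sum => b; apply: in_idealMl.
- apply: inj_row_free => v vJ.
  apply: (row_free_inj K_free); rewrite /= mul0mx.
  suff : (v *m K)^T = 0 by move/(congr1 trmx); rewrite trmxK trmx0.
  apply: inj_grad => [|l].
    by apply/trmx_inj; rewrite trmx_mul trmxK -mulmxA KM mulmx0 trmx0.
  pose gr := \col_i (\sum_b u 0 b * ((M b i)^`M(l)).@[a]).
  pose dw := \col_b ((w 0 b)^`M(l)).@[a].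
  (* Leibniz rule for e = w M: the first summand dies after multiplication by K. *)
  have de : \col_i ((e i)^`M(l)).@[a] = Ma^T *m dw + x *: gr.
    apply/colP=> i; rewrite !mxE /e /eV [_^T _ _]mxE [(_ *m _) _ _]mxE.
    rewrite (raddf_sum (mderiv l)) (raddf_sum (meval a)) mulr_sumr -big_split /=.
    apply: eq_bigr => b _; rewrite mderivM mevalD !mevalM.
    rewrite [Ma^T _ _]mxE [Ma _ _]mxE [dw _ _]mxE.
    have -> : (w 0 b).@[a] = x * u 0 b.
      by have /matrixP/(_ 0 b) := wau; rewrite [LHS]mxE [RHS]mxE.
    by rewrite mulrA [_ * (M b i).@[a]]mulrC.
  have Jl : col l (jacobian fs a) = x *: (K *m gr).
    rewrite scalemxAr -[RHS]add0r -(mul0mx _ dw) -KM -mulmxA -mulmxDr -de.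
    apply/colP=> s; rewrite !mxE fsE (raddf_sum (mderiv l)) (raddf_sum (meval a)).
    by apply: eq_bigr => i _; rewrite /= mderiv_mulC mevalM mevalC mxE.
  have : x * (v *m (K *m gr)) 0 0 = 0.
    have -> : x * (v *m (K *m gr)) 0 0 = (v *m col l (jacobian fs a)) 0 0.
      by rewrite Jl -scalemxAr [RHS]mxE.
    have /matrixP/(_ 0 l) := vJ; rewrite !mxE => vJl; rewrite -[RHS]vJl.
    by apply: eq_bigr => s _; rewrite mxE.
  move/eqP; rewrite mulf_eq0 (negPf x0) /= => /eqP; rewrite mulmxA mxE => vKgr.
  by rewrite -[RHS]vKgr; apply: eq_bigr => i _; rewrite [_^T _ _]mxE [gr _ _]mxE.
Qed.

End DeterminantalSmoothness.

(** * Dehomogenization and smooth points of hypersurfaces *)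

Section Charts.
Variables (r : nat) (c : 'I_r.+1).
Implicit Type m : 'X_{1..r.+1}.

Definition chart_mnm m : 'X_{1..r} := [multinom m (lift c j) | j < r].

Lemma mdeg_chart_mnm m : (m c + mdeg (chart_mnm m))%N = mdeg m.
Proof.
rewrite [in RHS]mdegE (bigD1_ord c) //= mdegE; congr (_ + _)%N.
by apply: eq_bigr => j _; rewrite mnmE.
Qed.

(** The exponent of the dropped variable is recovered from the total degree. *)
Lemma chart_mnm_inj d : {in [pred m | mdeg m == d] &, injective chart_mnm}.
Proof.
move=> m1 m2 /eqP d1 /eqP d2 eq12; apply/mnmP => l.
have [j ->|->] := unliftP c l.
  by have /mnmP/(_ j) := eq12; rewrite !mnmE.
by move: d1; rewrite -d2 -!mdeg_chart_mnm eq12 => /addIn.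
Qed.

Lemma chart_pt_mono (R : comNzRingType) (z : 'I_r -> R) m :
  \prod_l chart_pt c z l ^+ m l = \prod_j z j ^+ chart_mnm m j.
Proof.
rewrite (bigD1_ord c) //= /chart_pt unlift_none expr1n mul1r.
by apply: eq_bigr => j _; rewrite liftK mnmE.
Qed.

Variable k : fieldType.

Lemma dehomogE (F : {mpoly k[r.+1]}) :
  dehomog c F = \sum_(m <- msupp F) F@_m *: 'X_[chart_mnm m].
Proof.
rewrite /dehomog comp_mpolyEX; apply: eq_bigr => m _; congr (_ *: _).
rewrite comp_mpolyX [RHS]mpolyXE_id -chart_pt_mono.
by apply: eq_bigr => l _; rewrite tnth_mktuple.
Qed.

Lemma dehomog_neq0 d (F : {mpoly k[r.+1]}) :
  F != 0 -> F \is d.-homog -> dehomog c F != 0.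
Proof.
move=> F0 /dhomogP Fd.
pose m0 := mlead F; have m0F : m0 \in msupp F by apply: mlead_supp.
move: (m0F); apply: contraTneq => /(congr1 (mcoeff (chart_mnm m0))).
rewrite dehomogE raddf_sum mcoeff0 /= (bigD1_seq m0) //= big1_seq ?addr0.
  by rewrite mcoeffZ mcoeffX eqxx mulr1 mcoeff_msupp negbK => ->.
move=> m /andP[/negPf nm0 mF]; rewrite mcoeffZ mcoeffX.
case: eqP => [eqm|_]; last by rewrite mulr0.
by move: nm0; rewrite (@chart_mnm_inj d _ _ _ _ eqm) ?eqxx // inE /= Fd.
Qed.

End Charts.

(** The chain rule. Both sides obey the same Leibniz rule in f, so it is enough
    to compare them on variables. *)
Lemma mderiv_comp_mpoly (R : comNzRingType) n m (t : n.-tuple {mpoly R[m]})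
    (f : {mpoly R[n]}) l :
  (f \mPo t)^`M(l) = \sum_j (f^`M(j) \mPo t) * (tnth t j)^`M(l).
Proof.
pose P f := (f \mPo t)^`M(l) = \sum_j (f^`M(j) \mPo t) * (tnth t j)^`M(l).
have P1 : P 1.
  rewrite /P comp_mpoly1 -mpolyC1 mderivC big1 // => j _.
  by rewrite mderivC comp_mpoly0 mul0r.
have PM : forall f g, P f -> P g -> P (f * g).
  move=> {}f g Pf Pg; rewrite /P rmorphM /= mderivM Pf Pg mulr_suml mulr_sumr.
  rewrite -big_split /=; apply: eq_bigr => j _.
  by rewrite mderivM rmorphD !rmorphM /= mulrDl mulrAC mulrA.
have PX : forall i, P 'X_i.
  move=> i; rewrite /P comp_mpolyXU (bigD1 i) //= big1 ?addr0 => [|j /negPf nji].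
    rewrite mderivX mnm1E eqxx -[X in (X - _)%MM]addm0 addmC addmK mpolyX0.
    by rewrite scale1r comp_mpoly1 mul1r -tnth_nth.
  by rewrite mderivX mnm1E eq_sym nji scale0r comp_mpoly0 mul0r.
rewrite -/(P f); elim/mpolyind: f => [|c m1 f _ _ Pf].
  by rewrite /P comp_mpoly0 raddf0 big1 // => j _; rewrite !raddf0 mul0r.
rewrite /P rmorphD mderivD /= Pf; under [RHS]eq_bigr do
  rewrite mderivD rmorphD /= mulrDl.
rewrite big_split /=; congr (_ + _).
rewrite comp_mpolyZ mderivZ; under [RHS]eq_bigr do
  rewrite mderivZ comp_mpolyZ -scalerAl.
rewrite -scaler_sumr; congr (_ *: _); rewrite -/(P 'X_[m1]) mpolyXE_id.
by apply: big_ind => // i _; elim: (m1 i) => // e IHe; rewrite exprS; apply: PM.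
Qed.

(** The equations that cut out a hypersurface near a smooth point are multiples
    of f. If there were none, f would be zero; otherwise the differential at a of
    a multiple b f is b(a) times that of f, so the latter cannot vanish. *)
Lemma smooth_grad (k : fieldType) m (f : {mpoly k[m]}) a :
  f != 0 -> smooth_point (fun _ : unit => f) a ->
  exists j, (f^`M(j)).@[a] != 0.
Proof.
move=> f0 [/(_ tt) fa [[|c] [g [h [fg ha gf free]]]]].
  have [b] := gf tt; rewrite big_ord0 => /eqP; rewrite mulf_eq0 (negPf f0) orbF.
  by move/eqP => h0; rewrite h0 meval0 eqxx in ha.
have [b gE] := fg ord0.
have /rV0Pn[j] : row 0 (jacobian g a) != 0.
  apply: contraTneq free => row0; apply/row_freePn; exists ord0.
  by rewrite row0 sub0mx.
rewrite !mxE gE (big_pred1 tt) => [|[]] //.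
rewrite mderivM mevalD !mevalM fa mulr0 add0r.
by rewrite mulf_eq0 negb_or => /andP[_ fj]; exists j.
Qed.

(** * Forms of degree d as linear functionals on Veronese vectors *)

Section Forms.
Variables (k : fieldType) (r d : nat).
Implicit Types (F : {mpoly k[r.+1]}) (v : 'rV[k]_r.+1).
Local Notation monoms := (monoms r d).

Lemma sum_monoms (V : nmodType) (f : 'X_{1..r.+1} -> V) :
  \sum_(b < 'C(r + d, d)) f (nth 0%MM monoms b) = \sum_(m <- monoms) f m.
Proof. by rewrite (big_nth 0%MM) size_monoms big_mkord. Qed.

Lemma homog_monoms F (T : nmodType) (f : 'X_{1..r.+1} -> k -> T) :
  (forall m, f m 0 = 0) -> F \is d.-homog ->
  \sum_(m <- msupp F) f m F@_m = \sum_(m <- monoms) f m F@_m.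
Proof.
move=> f0 /dhomogP Fd.
rewrite [RHS](bigID (mem (msupp F))) /= [X in _ + X]big1 ?addr0; last first.
  by move=> m /memN_msupp_eq0 ->; rewrite f0.
rewrite -[RHS]big_filter; apply: perm_big; apply: uniq_perm => //.
  exact/filter_uniq/uniq_monoms.
by move=> m; rewrite mem_filter mem_monoms andb_idr // => /Fd/eqP.
Qed.

Definition form_of (u : 'rV[k]_('C(r + d, d))) : {mpoly k[r.+1]} :=
  \sum_b u 0 b *: 'X_[nth 0%MM monoms b].

Lemma form_of_homog u : form_of u \is d.-homog.
Proof.
apply: rpred_sum => b _; apply: rpredZ; rewrite dhomogX -mem_monoms.
by rewrite mem_nth // size_monoms.
Qed.

Lemma mcoeff_form_of u (b : 'I_('C(r + d, d))) :
  (form_of u)@_(nth 0%MM monoms b) = u 0 b.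
Proof.
rewrite raddf_sum (bigD1 b) //= mcoeffZ mcoeffX eqxx mulr1 big1 ?addr0 //.
move=> b' /negPf nb; rewrite mcoeffZ mcoeffX nth_uniq ?size_monoms ?uniq_monoms //.
by rewrite val_eqE nb mulr0.
Qed.

Lemma form_of_mcoeff F : F \is d.-homog ->
  form_of (\row_b F@_(nth 0%MM monoms b)) = F.
Proof.
move=> Fd; rewrite [RHS]mpolyE.
rewrite (homog_monoms (f := fun m a => a *: 'X_[m])) // => [|m].
  by rewrite -sum_monoms; apply: eq_bigr => b _; rewrite mxE.
by rewrite scale0r.
Qed.

Lemma meval_form_of u (x : 'I_r.+1 -> k) :
  (form_of u).@[x] = \sum_b u 0 b * \prod_l x l ^+ (nth 0%MM monoms b) l.
Proof.
by rewrite raddf_sum; apply: eq_bigr => b _; rewrite /= mevalZ mevalX.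
Qed.
End Forms.

(** * Smoothness of X when the singular points impose independent conditions *)

Definition separated (k : fieldType) (r n : nat) (p : 'I_n -> 'rV[k]_r.+1)
    (e : nat) (A : {set 'I_n}) (i : 'I_n) :=
  exists H : {mpoly k[r.+1]}, [/\ H \is e.-homog, H.@[p i ord0] != 0
    & forall j, j \in A -> H.@[p j ord0] = 0].

Lemma det_smooth_point_gt0 (k : fieldType) (m n N : nat)
    (M : 'M[{mpoly k[m]}]_(N, n)) (a : 'I_m -> k) (u : 'rV[k]_N) :
  let Ma := map_mx (meval a) M in
  (0 < N)%N -> u != 0 -> u *m Ma = 0 ->
  (forall v : 'rV_N, v *m Ma = 0 -> (v <= u)%MS) ->
  (forall nu : 'cV[k]_n, Ma *m nu = 0 ->
    (forall l, \sum_i nu i 0 * (\sum_b u 0 b * ((M b i)^`M(l)).@[a]) = 0) ->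
    nu = 0) ->
  smooth_point (fun f : {ffun 'I_N -> 'I_n} => \det (colsub f M)) a.
Proof. by case: N M u => // N M u Ma _; apply: det_smooth_point. Qed.

Lemma mxvec_index_inj m n (i i' : 'I_m) (j j' : 'I_n) :
  mxvec_index i j = mxvec_index i' j' -> i = i' /\ j = j'.
Proof.
by move/cast_ord_inj/enum_rank_inj => [-> ->].
Qed.

Section Smoothness.
Variables (k : fieldType) (r d n : nat) (p : 'I_n -> 'rV[k]_r.+1).
Variables (F : {mpoly k[r.+1]}) (c : 'I_n -> 'I_r.+1) (Q : {set 'I_n}).
Hypothesis pc : forall i, p i ord0 (c i) != 0.
Hypothesis Funiq : unique_hypersurface_through d p F.
Local Notation monoms := (monoms r d).

Let a := X_aff_coord c p.
Let M := veronese_mx d (fun i => chart_pt (c i)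
    (fun j : 'I_r => 'X_(mxvec_index i j) : {mpoly k[n * r]})).
Let Ma := map_mx (meval a) M.
Let u : 'rV[k]_('C(r + d, d)) := \row_b F@_(nth 0%MM monoms b).

Lemma chart_pt_aff_coord c0 (v : 'rV[k]_r.+1) l : v ord0 c0 != 0 ->
  chart_pt c0 (aff_coord c0 v) l = v ord0 l / v ord0 c0.
Proof.
move=> v0; rewrite /chart_pt /aff_coord.
by case: unliftP => [j ->|->] //; rewrite divff.
Qed.

Lemma aff_coordE i j : a (mxvec_index i j) = aff_coord (c i) (p i) j.
Proof. by rewrite /a /X_aff_coord mxvecE mxE. Qed.

Lemma veronese_chartE b i : M b i =
  'X_[chart_mnm (c i) (nth 0%MM monoms b)] \mPo
    [tuple 'X_(mxvec_index i j) : {mpoly k[n * r]} | j < r].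
Proof.
rewrite mxE chart_pt_mono comp_mpolyX; apply: eq_bigr => j _.
by rewrite tnth_mktuple.
Qed.

Lemma veronese_valueE b i : Ma b i =
  (\prod_l p i ord0 l ^+ (nth 0%MM monoms b) l) / (p i ord0 (c i)) ^+ d.
Proof.
rewrite mxE veronese_chartE comp_mpoly_meval mevalX.
transitivity (\prod_j aff_coord (c i) (p i) j
   ^+ chart_mnm (c i) (nth 0%MM monoms b) j).
  by apply: eq_bigr => j _; rewrite tnth_mktuple mevalXU aff_coordE.
rewrite -chart_pt_mono.
under eq_bigr do rewrite chart_pt_aff_coord // expr_div_n.
rewrite prodf_div; congr (_ / _); rewrite prodrXr -mdegE.
by congr (_ ^+ _); apply/eqP; rewrite -mem_monoms mem_nth // size_monoms.
Qed.

Lemma mul_veronese_value v i :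
  (v *m Ma) 0 i = (form_of v).@[p i ord0] / (p i ord0 (c i)) ^+ d.
Proof.
rewrite meval_form_of mulr_suml mxE; apply: eq_bigr => b _.
by rewrite veronese_valueE mulrA.
Qed.

Lemma form_of_coef_row : form_of u = F.
Proof. by have [[_ Fd] _ _] := Funiq; apply: form_of_mcoeff. Qed.

Lemma coef_row_neq0 : u != 0.
Proof.
have [[F0 _] _ _] := Funiq; apply: contraNneq F0 => u0.
rewrite -form_of_coef_row u0 /form_of big1 // => b _; by rewrite mxE scale0r.
Qed.

Lemma coef_row_kernel : u *m Ma = 0.
Proof.
have [_ Fp _] := Funiq.
by apply/rowP => i; rewrite mul_veronese_value form_of_coef_row Fp mul0r mxE.
Qed.

(** The forms vanishing at all the p_i are the multiples of F. *)
Lemma kernel_coef_row (v : 'rV_('C(r + d, d))) : v *m Ma = 0 -> (v <= u)%MS.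
Proof.
have [_ _ uniqF] := Funiq => vMa; have [->|v0] := eqVneq v 0; first exact: sub0mx.
have [||x _ eG] := uniqF (form_of v).
- split; last exact: form_of_homog.
  apply: contraNneq v0 => G0; apply/eqP/rowP=> b.
  by rewrite -mcoeff_form_of G0 mcoeff0 mxE.
- move=> i; have /rowP/(_ i) := vMa; rewrite mul_veronese_value mxE => /eqP.
  by rewrite mulf_eq0 invr_eq0 expf_eq0 (negPf (pc i)) andbF orbF => /eqP.
apply/sub_rVP; exists x; apply/rowP=> b.
by rewrite [RHS]mxE -(mcoeff_form_of v) eG mcoeffZ -(mcoeff_form_of u) form_of_coef_row.
Qed.

(** The i-th Veronese vector only involves the coordinates of the i-th factor,
    so the (i', j) derivative of F evaluated on it is zero unless i' = i. *)
Lemma grad_veronese i l :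
  \sum_b u 0 b * ((M b i)^`M(l)).@[a] =
  \sum_j ((dehomog (c i) F)^`M(j)).@[aff_coord (c i) (p i)]
     * (mxvec_index i j == l)%:R.
Proof.
have [[_ Fd] _ _] := Funiq.
set t := [tuple 'X_(mxvec_index i j) : {mpoly k[n * r]} | j < r].
transitivity ((dehomog (c i) F \mPo t)^`M(l)).@[a].
  rewrite dehomogE (homog_monoms (f := fun m a => a *: 'X_[chart_mnm (c i) m]) _ Fd).
    rewrite -sum_monoms (raddf_sum (comp_mpoly t)) (raddf_sum (mderiv l)).
    rewrite (raddf_sum (meval a)) /=; apply: eq_bigr => b _.
    by rewrite veronese_chartE comp_mpolyZ mderivZ mevalZ mxE.
  by move=> m; rewrite scale0r.
rewrite mderiv_comp_mpoly raddf_sum; apply: eq_bigr => j _ /=.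
rewrite mevalM comp_mpoly_meval; congr (_ * _).
  by apply: meval_eq => j'; rewrite tnth_mktuple mevalXU aff_coordE.
rewrite tnth_mktuple mderivX mnm1E mevalZ; case: eqP => [->|_].
  by rewrite -[X in (X - _)%MM]addm0 addmC addmK mpolyX0 meval1 mulr1.
by rewrite mul0r.
Qed.

Hypothesis grad_neq0 : forall i, i \notin Q ->
  exists j, ((dehomog (c i) F)^`M(j)).@[aff_coord (c i) (p i)] != 0.
Hypothesis sepQ : forall i, i \in Q -> separated p d (Q :\ i) i.

(** A relation nu killing the gradients vanishes outside Q, where the gradients
    are nonzero; pairing it with the form that separates p_i from the rest of Q
    leaves only the term nu_i. *)
Lemma X_smooth_in_charts : X_smooth_at d p.
Proof.
exists c => //; apply: (det_smooth_point_gt0 (u := u)).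
- by rewrite bin_gt0 leq_addl.
- exact: coef_row_neq0.
- exact: coef_row_kernel.
- exact: kernel_coef_row.
move=> nu Mnu grad0.
have nuNQ i : i \notin Q -> nu i 0 = 0.
  move=> /grad_neq0[j gj]; have := grad0 (mxvec_index i j).
  under eq_bigr do rewrite grad_veronese.
  rewrite (bigD1 i) //= [X in _ + X]big1 ?addr0 => [|i' ni]; last first.
    rewrite big1 ?mulr0 // => j' _; case: eqP => [/mxvec_index_inj[/eqP]|_].
      by rewrite (negPf ni).
    by rewrite mulr0.
  rewrite (bigD1 j) //= [X in _ + X]big1 ?addr0 => [|j' nj]; last first.
    case: eqP => [/mxvec_index_inj[_ /eqP]|_]; last by rewrite mulr0.
    by rewrite (negPf nj).
  by rewrite eqxx mulr1 => /eqP; rewrite mulf_eq0 (negPf gj) orbF => /eqP.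
apply/colP=> i; rewrite [RHS]mxE.
have [/sepQ[H [Hd Hi HQ]]|/nuNQ//] := boolP (i \in Q).
pose v : 'rV[k]_('C(r + d, d)) := \row_b H@_(nth 0%MM monoms b).
have vH : form_of v = H by apply: form_of_mcoeff.
have : (v *m Ma *m nu) 0 0 = 0 by rewrite -mulmxA Mnu mulmx0 mxE.
rewrite mxE (bigD1 i) //= big1 ?addr0 => [/eqP|j ji].
  rewrite mul_veronese_value vH !mulf_eq0 (negPf Hi) invr_eq0 expf_eq0 (negPf (pc i)).
  by rewrite andbF => /eqP.
have [jQ|/nuNQ->] := boolP (j \in Q); last by rewrite mulr0.
by rewrite mul_veronese_value vH HQ ?mul0r // !inE ji.
Qed.

End Smoothness.

(** For i not in Q the chart in which p_i is a smooth point of the hypersurface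
    is used, and any chart containing p_i for i in Q. *)
Lemma X_smooth_if_separated (k : fieldType) (r d n : nat)
    (p : 'I_n -> 'rV[k]_r.+1) (F : {mpoly k[r.+1]}) (Q : {set 'I_n}) :
  (forall i, p i != 0) -> unique_hypersurface_through d p F ->
  (forall i, i \in Q <-> in_sing_locus F (p i)) ->
  (forall i, i \in Q -> separated p d (Q :\ i) i) ->
  X_smooth_at d p.
Proof.
move=> p0 Funiq QE sepQ; have [[F0 Fd] Fp _] := Funiq.
pose good i (c : 'I_r.+1) := (p i ord0 c != 0) && ((i \in Q) ||
  [exists j, ((dehomog c F)^`M(j)).@[aff_coord c (p i)] != 0]).
have ex_good i : exists c, good i c.
  have [iQ|iQ] := boolP (i \in Q).
    have /rV0Pn[c pc] := p0 i; by exists c; rewrite /good pc iQ.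
  apply/existsP; apply: contraNT iQ => /existsPn bad; apply/QE; split=> //.
  move=> [c pc /(smooth_grad (dehomog_neq0 c F0 Fd)) ex_j].
  by have := bad c; rewrite /good pc (introT existsP ex_j) orbT.
have goodP i := xchooseP (ex_good i).
apply: (X_smooth_in_charts (c := fun i => xchoose (ex_good i)) (Q := Q) _ Funiq).
- by move=> i; have /andP[] := goodP i.
- by move=> i /negPf iQ; have /andP[_] := goodP i; rewrite iQ => /existsP.
- exact: sepQ.
Qed.

(** * Separating points by products of linear forms *)

Lemma card_between (T : finType) (A C : {set T}) t :
  A \subset C -> (#|A| <= t)%N -> (t <= #|C|)%N ->
  exists B : {set T}, [/\ A \subset B, B \subset C & #|B| = t].
Proof.
move=> + /subnK; move: (t - #|A|)%N => e.
elim: e A => [|e IHe] A sAC et leC; first by exists A.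
have [x xC xA] : exists2 x, x \in C & x \notin A.
  have : A \proper C by rewrite properEcard sAC; lia.
  by case/properP.
have [||//|B [sB sBC cB]] := IHe (x |: A).
- by rewrite subUset sub1set xC.
- by rewrite cardsU1 xA; lia.
by exists B; split=> //; apply: subset_trans sB; apply: subsetUr.
Qed.

Section Separation.
Variables (k : fieldType) (r n : nat) (p : 'I_n -> 'rV[k]_r.+1).
Implicit Types (A B Q : {set 'I_n}) (i j : 'I_n) (e t : nat).

Local Notation span A := (\sum_(i in A) <<p i>>)%MS.

Lemma separatedU e1 e2 A B i :
  separated p e1 A i -> separated p e2 B i -> separated p (e1 + e2) (A :|: B) i.
Proof.
move=> [H1 [H1e H1i H1A]] [H2 [H2e H2i H2B]]; exists (H1 * H2); split.
- exact: dhomogM.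
- by rewrite mevalM mulf_neq0.
by move=> j /setUP[/H1A|/H2B] Hj; rewrite mevalM Hj ?mul0r ?mulr0.
Qed.

(** A point outside a linear subspace is separated from it by some column of a
    matrix whose left kernel is that subspace. *)
Lemma separated1 A i : ~~ (p i <= span A)%MS -> separated p 1 A i.
Proof.
rewrite submxE => /rV0Pn[b]; set L := cokermx _ => pLb.
have evalL (v : 'rV[k]_r.+1) :
    (\sum_l L l b *: 'X_l : {mpoly k[r.+1]}).@[v ord0] = (v *m L) 0 b.
  rewrite raddf_sum mxE; apply: eq_bigr => l _.
  by rewrite /= mevalZ mevalXU mulrC.
exists (\sum_l L l b *: 'X_l); split.
- by apply: rpred_sum => l _; apply: rpredZ; rewrite dhomogX; apply/eqP/mdeg1.
- by rewrite evalL.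
move=> j jA; rewrite evalL.
have : (p j <= span A)%MS by rewrite (sumsmx_sup j) // genmxE.
by rewrite submxE => /eqP ->; rewrite mxE.
Qed.

Hypothesis p_neq0 : forall i, p i != 0.

Lemma separated0_set0 i : separated p 0 set0 i.
Proof.
exists 1; split; [exact: dhomog1 | by rewrite meval1 oner_eq0 |].
by move=> j; rewrite inE.
Qed.

(** A factor nonzero at p_i raises the degree. *)
Lemma separated_leq e1 e2 A i :
  (e1 <= e2)%N -> separated p e1 A i -> separated p e2 A i.
Proof.
move=> /subnK <- sepA; elim: (e2 - e1)%N => [|e IHe] //.
rewrite -(setU0 A) addSn -addn1; apply: separatedU => //; apply: separated1.
by rewrite big_set0 submx0.
Qed.

(** Split A into e groups of at most t points; each is cut out by a linear form
    not vanishing at p_i. *)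
Lemma separated_groups t e A i : (0 < t)%N ->
  (forall B, B \subset A -> (#|B| <= t)%N -> ~~ (p i <= span B)%MS) ->
  (#|A| <= e * t)%N -> separated p e A i.
Proof.
move=> t0; elim: e A => [|e IHe] A sepA leA.
  move: leA; rewrite mul0n leqn0 cards_eq0 => /eqP ->; exact: separated0_set0.
have [leAt|ltA] := leqP #|A| t.
  by apply: (@separated_leq 1) => //; apply/separated1/sepA.
have t_ge0 : (#|set0 : {set 'I_n}| <= t)%N by rewrite cards0.
have [B [_ sBA cB]] := card_between (sub0set A) t_ge0 (ltnW ltA).
rewrite -(setID A B) (setIidPr sBA) -add1n; apply: separatedU.
  by apply/separated1/sepA; rewrite ?cB.
apply: IHe => [C sC|]; first by apply: sepA; apply: subset_trans sC (subsetDl _ _).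
by rewrite cardsDS // cB leq_subLR -mulSn.
Qed.

Lemma rank_span A : (\rank (span A) <= #|A|)%N.
Proof.
rewrite -sum1_card; elim/big_rec2: _ => [|i m S _ rkS]; first by rewrite mxrank0.
apply: leq_trans (mxrank_adds_leqif _ _) _; apply: leq_add rkS.
by rewrite mxrank_gen rank_leq_row.
Qed.

(** Take B of maximal size. Adding any further p_j brings p_i into the span; by
    exchange, p_j then lies in the span of B and p_i. *)
Lemma span_extension Q i : exists B, [/\ B \subset Q :\ i,
  ~~ (p i <= span B)%MS & (\rank (span Q) <= #|B|.+1)%N].
Proof.
pose P B := (B \subset Q :\ i) && ~~ (p i <= span B)%MS.
have P0 : P set0 by rewrite /P sub0set big_set0 submx0 p_neq0.
have [B /andP[sB pB] maxB] := arg_maxnP (fun B => #|B|) P0.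
exists B; split=> //.
suff : (span Q <= span B + p i)%MS.
  move/mxrankS/leq_trans; apply.
  apply: leq_trans (mxrank_adds_leqif _ _) _.
  by have := rank_span B; have := rank_leq_row (p i); lia.
apply/sumsmx_subP => j jQ; rewrite genmxE.
have [->|ji] := eqVneq j i; first exact: addsmxSr.
have [jB|jB] := boolP (j \in B).
  by apply: submx_trans (addsmxSl _ _); rewrite (sumsmx_sup j) // genmxE.
have : (p i <= span (j |: B))%MS.
  apply: contraT => pjB; have := maxB (j |: B).
  rewrite cardsU1 jB /P pjB andbT subUset sub1set !inE ji jQ sB /=.
  by move=> /(_ isT); rewrite ltnn.
rewrite big_setU1 //= addsmxC => /sub_addsmxP[[x y] /= ep].
have /submxP[z ez] : (y *m <<p j>> <= p j)%MS.
  by apply: submx_trans (submxMl _ _) _; rewrite genmxE.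
have z0 : z 0 0 != 0.
  apply: contraNneq pB => z0; rewrite ep ez (mx11_scalar z) z0 mul_scalar_mx.
  by rewrite scale0r addr0 submxMl.
move: ep; rewrite ez (mx11_scalar z) mul_scalar_mx => ep.
have -> : p j = (z 0 0)^-1 *: (p i - x *m span B).
  by rewrite ep addrC addKr scalerA mulVf // scale1r.
apply: scalemx_sub; apply: addmx_sub; first exact: addsmxSr.
by rewrite eqmx_opp; apply: submx_trans (submxMl _ _) (addsmxSl _ _).
Qed.

(** One linear form deals with the set B of [span_extension], and at most e * t
    other points remain. *)
Lemma separated_rank t Q i : i \in Q -> (0 < t)%N ->
  (forall B, B \subset Q :\ i -> (#|B| <= t)%N -> ~~ (p i <= span B)%MS) ->
  forall e, (#|Q| <= \rank (span Q) + e * t)%N -> separated p e.+1 (Q :\ i) i.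
Proof.
move=> iQ t0 gen e leQ; have [B [sB pB rkB]] := span_extension Q i.
rewrite -(setID (Q :\ i) B) (setIidPr sB) -add1n; apply: separatedU.
  exact: separated1.
apply: (separated_groups t0) => [C sC|].
  by apply: gen; apply: subset_trans sC (subsetDl _ _).
have cQ := cardsD1 i Q; rewrite iQ add1n in cQ.
rewrite cardsDS // leq_subLR -ltnS -cQ -addSn; apply: leq_trans leQ _.
by rewrite leq_add2r.
Qed.

(** Enlarge B to a set C of t points of Q other than i: the t + 1 points of C
    and i are independent, so p_i is not in the span of C. *)
Lemma general_notin_span Q t i : is_general p Q t%:Z -> (t < #|Q|)%N -> i \in Q ->
  forall B, B \subset Q :\ i -> (#|B| <= t)%N -> ~~ (p i <= span B)%MS.
Proof.
move=> gen ltQ iQ B sB leB.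
have cQ := cardsD1 i Q; rewrite iQ add1n in cQ.
have [|C [sBC sC cC]] := card_between sB leB; first by rewrite -ltnS -cQ.
have iC : i \notin C.
  by apply/negP => /(subsetP sC); rewrite !inE eqxx.
apply/negP => pB.
have /forallP/(_ (i |: C)) := gen.
rewrite cardsU1 iC cC -PoszD addnC eqxx andbT subUset sub1set iQ.
rewrite (subset_trans sC (subD1set _ _)) /= /proj_dim big_setU1 //= subr_eq -PoszD.
rewrite eqz_nat => /eqP rkC.
have : (<<p i>> + span C <= span C)%MS.
  rewrite addsmx_sub submx_refl genmxE andbT; apply: submx_trans pB _.
  apply/sumsmx_subP => j jB; rewrite (sumsmx_sup j) //.
  exact: (subsetP sBC).
by move/mxrankS; rewrite rkC => /leq_trans/(_ (rank_span C)); rewrite cC addn1 ltnn.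
Qed.

Lemma distinct_notin_span Q i :
  {in Q &, forall i j, (p i == p j)%MS -> i = j} -> i \in Q ->
  forall B, B \subset Q :\ i -> (#|B| <= 1)%N -> ~~ (p i <= span B)%MS.
Proof.
move=> inj iQ B sB; rewrite leq_eqVlt ltnS leqn0 cards_eq0 => /orP[|/eqP->]; last first.
  by rewrite big_set0 submx0.
move=> /cards1P[j eB]; move: sB; rewrite {}eB sub1set !inE big_set1 genmxE.
move=> /andP[ji jQ]; apply: contra ji => pij; apply/eqP/esym/inj => //.
by have [_ <-] := mxrank_leqif_eq pij; rewrite !rank_rV !p_neq0.
Qed.

Lemma distinct_general1 Q :
  {in Q &, forall i j, (p i == p j)%MS -> i = j} -> is_general p Q 1.
Proof.
move=> inj; apply/forallP => G; apply/implyP => /andP[sG +].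
rewrite eqz_nat => /cards2P[i [j [ij eG]]]; move: sG; rewrite {}eG => sG.
have [iQ jQ] : i \in Q /\ j \in Q.
  by split; apply: (subsetP sG); rewrite !inE eqxx ?orbT.
have pij : ~~ (p i <= span [set j])%MS.
  apply: (distinct_notin_span inj iQ); last by rewrite cards1.
  by rewrite sub1set !inE eq_sym ij.
have := rank_span [set i; j]; rewrite cards2 ij => rk2.
suff rk1 : (1 < \rank (span [set i; j]))%N.
  by rewrite /proj_dim (_ : \rank _ = 2)%N //; lia.
rewrite big_setU1 ?inE //= ltn_neqAle.
have [le1] := mxrank_leqif_sup (addsmxSr <<p i>>%MS (span [set j])).
move: le1; rewrite addsmx_sub submx_refl andbT genmxE (negPf pij).
by rewrite big_set1 mxrank_gen rank_rV p_neq0 => -> ->.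
Qed.

(** Distinct points are 1-general, so the maximum defining t is attained at an
    index at least 2; in particular t is positive and can be divided by. *)
Lemma t_generalP Q : {in Q &, forall i j, (p i == p j)%MS -> i = j} ->
  (1 < #|Q|)%N ->
  exists t : nat, [/\ t_general p Q = t%:Z, (0 < t < #|Q|)%N & is_general p Q t%:Z].
Proof.
move=> inj Q1.
pose P (e : 'I_#|Q|.+1) := is_general p Q (e%:Z - 1).
have P2 : P (inord 2).
  by rewrite /P inordK //; apply: distinct_general1.
have [e Pe maxe] := arg_maxnP (fun e : 'I_#|Q|.+1 => e : nat) P2.
have e2 : (2 <= e)%N by have := maxe _ P2; rewrite inordK.
have eE : e.-1%:Z = e%:Z - 1 by lia.
exists e.-1; split; last by rewrite eE.
- rewrite eE /t_general; congr (_%:Z - 1); apply/eqP; rewrite eqn_leq.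
  by rewrite (leq_bigmax_cond e) // andbT; apply/bigmax_leqP.
- have := ltn_ord e; lia.
Qed.

End Separation.

Lemma ceil_div_le (a t : nat) (e : int) : (0 < t)%N ->
  Num.ceil (a%:Z%:~R / t%:Z%:~R : rat) <= e -> a%:Z <= e * t%:Z.
Proof.
move=> t0; rewrite ceil_le_int ler_pdivrMr; last by rewrite ltr0z.
by rewrite -intrM ler_int.
Qed.

Theorem corollary4p10 (k : fieldType) (r d n : nat)
    (p : 'I_n -> 'rV[k]_r.+1) (F : {mpoly k[r.+1]}) (Q : {set 'I_n}) :
  (2 <= r)%N -> (2 <= d)%N -> ('C(r + d, d) <= n)%N ->
  (forall i, p i != 0) ->
  in_X d p ->
  unique_hypersurface_through d p F ->
  (forall i, i \in Q <-> in_sing_locus F (p i)) ->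
  {in Q &, forall i j, (p i == p j)%MS -> i = j} ->
  [/\ #|Q|%:Z - proj_dim p Q <= d%:Z -> X_smooth_at d p,
      (#|Q| <= d.+1)%N -> X_smooth_at d p,
      [pchar k] =i pred0 ->
        Num.ceil ((#|Q|%:Z - proj_dim p Q - 1)%:~R / (t_general p Q)%:~R : rat)
          + 1 <= d%:Z ->
        X_smooth_at d p
    & [pchar k] =i pred0 ->
        t_general p Q = proj_dim p Q ->
        Num.ceil ((#|Q|%:Z - 1)%:~R / (proj_dim p Q)%:~R : rat) <= d%:Z ->
        X_smooth_at d p].
Proof.
move=> _ d2 _ p0 _ Funiq QE inj.
have key := X_smooth_if_separated p0 Funiq QE.
have cQ i : i \in Q -> #|Q| = #|Q :\ i|.+1.
  by move=> iQ; rewrite (cardsD1 i) iQ.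
(* With at most one singular point, t and dim <Z> may be 0 or -1 and the bounds on
   d degenerate; a power of a linear form nonzero at the point then suffices. *)
have single i : i \in Q -> (#|Q| <= 1)%N -> separated p d (Q :\ i) i.
  move=> iQ; rewrite (cQ i iQ) ltnS leqn0 cards_eq0 => /eqP ->.
  exact/(separated_leq p0 (leq0n d))/separated0_set0.
have rkQ : (\rank (\sum_(i in Q) <<p i>>)%MS <= #|Q|)%N by apply: rank_span.
have sepD1 i : (#|Q| <= \rank (\sum_(i in Q) <<p i>>)%MS + d.-1)%N ->
    i \in Q -> separated p d (Q :\ i) i.
  move=> leQ iQ; rewrite -(prednK (ltnW d2)).
  apply: (separated_rank p0 iQ (ltnSn 0) (distinct_notin_span p0 inj iQ)).
  by rewrite muln1.
split.
- rewrite /proj_dim => leQ; apply: key => i; apply: sepD1; lia.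
- move=> leQ; apply: key => i iQ.
  apply: (separated_groups p0 (ltnSn 0) (distinct_notin_span p0 inj iQ)).
  by rewrite muln1 -ltnS -cQ.
- move=> _ leQ; apply: key => i iQ; have [/single//|Q1] := leqP #|Q| 1; first exact.
  have [t [tE /andP[t0 ltQ] gen]] := t_generalP p0 inj Q1.
  rewrite -(prednK (ltnW d2)).
  apply: (separated_rank p0 iQ t0 (general_notin_span gen ltQ iQ)).
  move: leQ; rewrite tE /proj_dim.
  rewrite (_ : _ - _ - 1 = (#|Q| - \rank (\sum_(i in Q) <<p i>>)%MS)%N%:Z); last lia.
  rewrite -lerBrDr => /(ceil_div_le t0).
  have -> : d%:Z - 1 = d.-1%:Z by lia.
  by rewrite -PoszM lez_nat leq_subLR.
move=> _ tdim leQ; apply: key => i iQ; have [/single//|Q1] := leqP #|Q| 1; first exact.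
have [t [tE /andP[t0 ltQ] gen]] := t_generalP p0 inj Q1.
apply: (separated_groups p0 t0 (general_notin_span gen ltQ iQ)).
move: leQ; rewrite -tdim tE (cQ i iQ).
rewrite (_ : _ - 1 = #|Q :\ i|%:Z); last lia.
by move/(ceil_div_le t0); rewrite -PoszM lez_nat.
Qed.
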